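(* Let $(x^k)_{k\in\mathbb{N}}$ be the sequence generated by GInexPM with constant step size $\alpha$ (as described in the context), let $\Omega^*\neq\varnothing$, and set $\rho:=\alpha/(1-2\bar\gamma_2)$ and $\eta:=f(x^0)-f^*+\rho\,b_{-1}$. Then, for every $N\in\mathbb{N}$, there holds $$\min_{k=0,1,\dots,N}\langle\nabla f(x^k),x^k-x\rangle\le\left[\frac1{2\alpha}\|x^0-x\|^2+\eta\right]\frac1{N+1},\qquad\forall\,x\in C.$$ As a consequence, given $\epsilon>0$, the maximum number of iterations $N$ necessary for the algorithm to generate an iterate $x^\ell$ such that $\langle\nabla f(x^\ell),x-x^\ell\rangle>-\epsilon$, for all $x\in C$, is $N\ge\left[\frac{1}{2\alpha}\|x^0-x\|^2+\eta\right]/\epsilon-1$.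
   Context: Setting. $C\subset\mathbb{R}^n$ is a closed convex set, $f:\mathbb{R}^n\to\mathbb{R}$ is continuously differentiable (no convexity of $f$ is assumed), the problem is to minimize $f$ over $C$, $f^*:=\inf_{x\in C}f(x)$ is the optimal value, $\Omega^*$ is the set of minimizers of $f$ over $C$, $\langle\cdot,\cdot\rangle$ and $\|\cdot\|$ are the Euclidean inner product and norm, and $\mathbb{N}=\{0,1,2,\dots\}$. The gradient is Lipschitz continuous on $C$ with constant $L>0$: $\|\nabla f(x)-\nabla f(y)\|\le L\|x-y\|$ for all $x,y\in C$. Inexact projection. For $\gamma=(\gamma_1,\gamma_2,\gamma_3)\in\mathbb{R}^3_+$ (nonnegative entries), the error tolerance $\varphi_\gamma:\mathbb{R}^n\times\mathbb{R}^n\times\mathbb{R}^n\to\mathbb{R}_+$ is a function with $\varphi_\gamma(u,v,w)\le\gamma_1\|v-u\|^2+\gamma_2\|w-v\|^2+\gamma_3\|w-u\|^2$ for all $u,v,w\in\mathbb{R}^n$. For $u\in C$ and $v\in\mathbb{R}^n$, the set of feasible inexact projections of $v$ onto $C$ relative to $u$ is $\mathcal{P}_C(\varphi_\gamma,u,v):=\{w\in C:\langle v-w,y-w\rangle\le\varphi_\gamma(u,v,w)\ \ \forall y\in C\}$. GInexPM with constant step size. Fix a nonincreasing sequence $(b_k)_{k\in\mathbb{N}}$ of nonnegative reals converging to $0$, a real $b_{-1}>0$ with $b_{-1}>b_0$, and reals $a_k$ with $0\le a_k\le b_{k-1}-b_k$ for all $k\in\mathbb{N}$. Fix constants $\bar\gamma_2<1/2$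 and $\bar\gamma<1/2$ and a step size $\alpha$ with $0<\alpha<(1-2\bar\gamma)/L$. Start from $x^0\in C$. At iteration $k$: if $\nabla f(x^k)=0$, stop; otherwise choose reals $\gamma_1^k,\gamma_2^k,\gamma_3^k\ge0$ with $\gamma_1^k+\gamma_2^k\le a_k/\|\nabla f(x^k)\|^2$, $\gamma_2^k<\bar\gamma_2$, $\gamma_3^k<\bar\gamma$, set $\gamma^k:=(\gamma_1^k,\gamma_2^k,\gamma_3^k)$ and $z^k:=x^k-\alpha\nabla f(x^k)$, and let $x^{k+1}$ be any element of $\mathcal{P}_C(\varphi_{\gamma^k},x^k,z^k)$.
   Formalization: In the closing claim ''for all x ∈ C'' is taken outermost: for each x ∈ C and each N at least the stated bound (which depends on x), some ℓ ≤ N satisfies the inequality, and ℓ may depend on x; one ℓ serving all x does not follow and can fail for nonconvex f. *)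

(* Defs.v *)
From mathcomp Require Import all_boot all_order all_algebra.
From mathcomp Require Import all_classical all_reals all_analysis.

Set Implicit Arguments.
Unset Strict Implicit.
Unset Printing Implicit Defensive.

Import Order.TTheory GRing.Theory Num.Theory.
Import numFieldNormedType.Exports.

Local Open Scope classical_set_scope.
Local Open Scope ring_scope.

Section Defs.
Context {R : realType} {n : nat}.
Implicit Types (C : set 'rV[R]_n) (f : 'rV[R]_n -> R) (u v w x y : 'rV[R]_n).

Definition dot u v : R := \sum_(i < n) u 0 i * v 0 i.

(* The library norm `|u| on 'rV[R]_n is the sup norm, hence this definition;
   both norms induce the same topology. *)
Definition enorm u : R := Num.sqrt (dot u u).

Definition grad f x : 'rV[R]_n := \row_(i < n) 'D_(delta_mx 0 i) f x.

Definition continuously_differentiable f : Prop :=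
  (forall x, differentiable f x) /\ continuous (grad f).

Definition lipschitz_gradient_on f C (L : R) : Prop :=
  forall x y, C x -> C y -> enorm (grad f x - grad f y) <= L * enorm (x - y).

Definition minimizers f C : set 'rV[R]_n :=
  [set x | C x /\ forall y, C y -> f x <= f y].

Definition optimal_value f C : R := inf [set f x | x in C].

(* A family of error tolerances phi_gamma, one function of (u, v, w) for each
   nonnegative gamma = (g1, g2, g3). *)
Definition error_tolerance
    (phi : R -> R -> R -> 'rV[R]_n -> 'rV[R]_n -> 'rV[R]_n -> R) : Prop :=
  forall g1 g2 g3, 0 <= g1 -> 0 <= g2 -> 0 <= g3 ->
  forall u v w, 0 <= phi g1 g2 g3 u v w /\
    phi g1 g2 g3 u v w <= g1 * enorm (v - u) ^+ 2 + g2 * enorm (w - v) ^+ 2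
                          + g3 * enorm (w - u) ^+ 2.

Definition inexact_proj C (phi : 'rV[R]_n -> 'rV[R]_n -> 'rV[R]_n -> R) u v :
    set 'rV[R]_n :=
  [set w | C w /\ forall y, C y -> dot (v - w) (y - w) <= phi u v w].

(* prev_seq bm1 b k is b_(k-1), where bm1 stands for the extra term b_(-1). *)
Definition prev_seq (bm1 : R) (b : nat -> R) (k : nat) : R :=
  if k is k'.+1 then b k' else bm1.

Definition admissible_parameters (bm1 : R) (b a : nat -> R) : Prop :=
  [/\ nonincreasing_seq b, (forall k, 0 <= b k), b @ \oo --> 0,
      0 < bm1 /\ b 0%N < bm1 &
      forall k, 0 <= a k /\ a k <= prev_seq bm1 b k - b k].

(* x is generated by the method with constant step size alpha.  A run that stops
   at iteration k, i.e. with a zero gradient at x k, is encoded as the sequence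
   that repeats its last iterate x k, so every run, finite or infinite, is a
   sequence indexed by nat whose values are exactly the generated points. *)
Definition GInexPM C f phi (a : nat -> R) (gbar2 gbar alpha : R)
    (x : nat -> 'rV[R]_n) : Prop :=
  C (x 0%N) /\
  forall k,
    (grad f (x k) = 0 -> x k.+1 = x k) /\
    (grad f (x k) <> 0 ->
      exists g1 g2 g3 : R,
        [/\ [/\ 0 <= g1, 0 <= g2 & 0 <= g3],
            g1 + g2 <= a k / enorm (grad f (x k)) ^+ 2,
            g2 < gbar2, g3 < gbar &
            inexact_proj C (phi g1 g2 g3) (x k) (x k - alpha *: grad f (x k))
              (x k.+1)]).

End Defs.

(* Main.v *)
Require Import Defs.
From mathcomp Require Import all_boot all_order all_algebra.
From mathcomp Require Import all_classical all_reals all_analysis.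
From mathcomp Require Import ring lra.
Import Order.TTheory GRing.Theory Num.Theory.
Import numFieldNormedType.Exports.
Local Open Scope classical_set_scope.
Local Open Scope ring_scope.

(** Write d_k = x_(k+1) - x_k and let c > 0 be
    (1 - 2 gbar - alpha L) / (2 alpha).  The heart of the proof is that one
    iteration satisfies, for every y in C,
[[
    <grad f(x_k), x_k - y> + c |d_k|^2
      <= (|x_k - y|^2 - |x_(k+1) - y|^2) / (2 alpha)
         + f(x_k) - f(x_(k+1)) + rho a_k
]]
    ([gradient_step_bound]).  Three inequalities are combined.  The inexact
    projection, tested against y, bounds the gap <grad f(x_k), x_k - y> by the
    decrease of the squared distance to y, up to a multiple of
    <grad f(x_k), d_k> and the projection error.  The same projection, tested
    against x_k itself, says that d_k is a descent direction up to the error.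
    Finally [descent_lemma], the quadratic upper bound that comes from the
    Lipschitz gradient, trades <grad f(x_k), d_k> for f(x_(k+1)) - f(x_k).  The
    bound on alpha leaves a multiple c of |d_k|^2 to spare.

    The right-hand sides telescope, and the a_k sum to at most b_(-1)
    ([sum_tolerances_le], [GInexPM_energy]).  Since f(x_N) is at least the
    optimal value, which is a genuine lower bound because f has a minimizer on
    C, this gives
[[
    sum_(k < N) <grad f(x_k), x_k - y> + c sum_(k < N) |d_k|^2
      + |x_N - y|^2 / (2 alpha)  <=  |x_0 - y|^2 / (2 alpha) + eta.
]]
    The minimum of the gaps is at most their mean, which proves the first claim.

    The complexity claim asks for a gap strictly below eps, whereas the first
    claim only gives a gap of at most eps.  This is where the squared terms kept
    on the left serve: if the first N + 1 gaps were all at least eps, the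
    inequality at N + 1 would be an equality and both squared terms would
    vanish.  Then x_(N+1) = y and d_N = 0, so x_N = y and the gap at x_N is 0, not at
    least eps. *)

(** * The Euclidean inner product *)

Section Euclidean.
Context {R : realType} {n : nat}.
Implicit Types (u v w : 'rV[R]_n) (a : R).

Lemma dotC u v : dot u v = dot v u.
Proof. by apply: eq_bigr => i _; rewrite mulrC. Qed.

Lemma dotDl u v w : dot (u + v) w = dot u w + dot v w.
Proof. by rewrite /dot -big_split; apply: eq_bigr => i _; rewrite mxE mulrDl. Qed.

Lemma dotZl a u v : dot (a *: u) v = a * dot u v.
Proof. by rewrite /dot mulr_sumr; apply: eq_bigr => i _; rewrite mxE mulrA. Qed.

Lemma dotNl u v : dot (- u) v = - dot u v.
Proof. by rewrite -scaleN1r dotZl mulN1r. Qed.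

Lemma dotDr u v w : dot u (v + w) = dot u v + dot u w.
Proof. by rewrite dotC dotDl !(dotC u). Qed.

Lemma dotZr a u v : dot u (a *: v) = a * dot u v.
Proof. by rewrite dotC dotZl (dotC v). Qed.

Lemma dotNr u v : dot u (- v) = - dot u v.
Proof. by rewrite dotC dotNl (dotC v). Qed.

Definition dotE := (dotDl, dotDr, dotNl, dotNr, dotZl, dotZr).

Lemma dot0l v : dot 0 v = 0.
Proof. by rewrite -(scale0r 0) dotZl mul0r. Qed.

Lemma dot0r v : dot v 0 = 0.
Proof. by rewrite dotC dot0l. Qed.

Lemma dotvv_ge0 v : 0 <= dot v v.
Proof. by apply: sumr_ge0 => i _; rewrite -expr2 sqr_ge0. Qed.

Lemma dotvv_eq0 v : dot v v = 0 -> v = 0.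
Proof.
move=> v0; apply/rowP => i; rewrite mxE; apply/eqP; rewrite -sqrf_eq0.
have /psumr_eq0P H : forall i, true -> 0 <= v 0 i * v 0 i.
  by move=> j _; rewrite -expr2 sqr_ge0.
by apply/eqP; rewrite expr2; apply: (H v0).
Qed.

Lemma enorm_ge0 v : 0 <= enorm v.
Proof. exact: sqrtr_ge0. Qed.

Lemma enorm_sq v : enorm v ^+ 2 = dot v v.
Proof. by rewrite sqr_sqrtr ?dotvv_ge0. Qed.

Lemma enorm_eq0 v : enorm v = 0 -> v = 0.
Proof. by move=> v0; apply: dotvv_eq0; rewrite -enorm_sq v0 expr0n. Qed.

(** For nonzero vectors, the squared length of |v| u - |u| v is nonnegative and
    equals 2 |u| |v| (|u| |v| - <u, v>). *)
Lemma cauchy_schwarz u v : dot u v <= enorm u * enorm v.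
Proof.
have [/enorm_eq0->|u0] := eqVneq (enorm u) 0.
  by rewrite dot0l mulr_ge0 ?enorm_ge0.
have [/enorm_eq0->|v0] := eqVneq (enorm v) 0.
  by rewrite dot0r mulr_ge0 ?enorm_ge0.
have uv_gt0 : 0 < enorm u * enorm v.
  by rewrite mulr_gt0 // lt_def ?u0 ?v0 enorm_ge0.
rewrite -subr_ge0 -(pmulr_rge0 _ uv_gt0).
have := dotvv_ge0 (enorm v *: u - enorm u *: v).
rewrite !dotE -!enorm_sq (dotC v u); lra.
Qed.

Lemma enormZ a v : 0 <= a -> enorm (a *: v) = a * enorm v.
Proof.
move=> a0; rewrite /enorm !dotE mulrA sqrtrM ?mulr_ge0//.
by rewrite -expr2 sqrtr_sqr ger0_norm.
Qed.

End Euclidean.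

(** * The descent lemma on a convex set *)

Section Descent.
Context {R : realType} {n : nat}.
Implicit Types (f : 'rV[R]_n -> R) (C : set 'rV[R]_n) (x y d : 'rV[R]_n).

Lemma derive_dot_grad f x d : differentiable f x -> 'D_d f x = dot (grad f x) d.
Proof.
move=> dfx; rewrite deriveE// {1}(row_sum_delta d) linear_sum /dot.
by apply: eq_bigr => i _; rewrite linearZ/= mxE deriveE// mulrC.
Qed.

Lemma is_derive_along f x d (t : R) : differentiable f (x + t *: d) ->
  is_derive t 1 (fun s : R => f (x + s *: d)) (dot (grad f (x + t *: d)) d).
Proof.
move=> dfx.
(* Both derivatives are limits of the same difference quotient. *)
have shiftE : (fun h : R => h^-1 *: (((fun s : R => f (x + s *: d)) \o shift t)
      (h *: (1 : R)) - f (x + t *: d))) =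
    (fun h : R => h^-1 *: ((f \o shift (x + t *: d)) (h *: d) - f (x + t *: d))).
  apply/funext => h /=; congr (_ *: (f _ - _)).
  by rewrite /shift/= scalerDl [h *: 1]mulr1 addrCA.
apply: DeriveDef.
  by rewrite /derivable shiftE; exact: diff_derivable.
by rewrite -derive_dot_grad// /derive shiftE.
Qed.

Lemma convex_set_segment C x y (t : R) : convex_set C -> C x -> C y ->
  0 <= t <= 1 -> C (x + t *: (y - x)).
Proof.
move=> Cconv Cx Cy t01.
have := Cconv y x (Itv01 (proj1 (andP t01)) (proj2 (andP t01))).
rewrite !inE => /(_ Cy Cx); congr C; rewrite /conv /= /unstable.onem.
by rewrite scalerBl scale1r scalerBr addrCA addrA addrAC -addrA addrCA.
Qed.

(** The gradient is Lipschitz on C only, and C is convex, so the segment from x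
    to y is where the bound may be used.  The difference of the two sides, as a
    function h of the position t on this segment, has a nonpositive derivative
    by Cauchy-Schwarz, so the mean value theorem gives h 1 <= h 0. *)
Lemma descent_lemma f C (L : R) x y : convex_set C ->
  (forall z, differentiable f z) -> lipschitz_gradient_on f C L ->
  C x -> C y ->
  f y <= f x + dot (grad f x) (y - x) + L / 2 * dot (y - x) (y - x).
Proof.
move=> Cconv df lip Cx Cy; set d := y - x.
pose h (t : R) : R := f (x + t *: d) - t * dot (grad f x) d
  - L / 2 * dot d d * t ^+ 2.
pose dh (t : R) : R := dot (grad f (x + t *: d)) d - dot (grad f x) d
  - L / 2 * dot d d * (2 * t).
have h_derive (t : R) : is_derive t 1 h (dh t).
  have Hf := is_derive_along f x d t (df _).
  rewrite /h /dh; apply: is_derive_eq.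
  rewrite /GRing.scale/=; ring.
have h_cont : {within `[0, 1], continuous h}.
  apply: continuous_subspaceT => t.
  have /derivable1_diffP : derivable h t 1 by case: (h_derive t).
  exact: differentiable_continuous.
have [t t01 ht] := MVT ltr01 (fun t _ => h_derive t) h_cont.
move: t01; rewrite in_itv/= => /andP[t0 t1].
have dh_le0 : dh t <= 0.
  have lip_t : enorm (grad f (x + t *: d) - grad f x) <= L * (t * enorm d).
    have := lip _ _ (convex_set_segment C x y t Cconv Cx Cy _) Cx.
    rewrite (ltW t0) (ltW t1) => /(_ isT).
    by rewrite [x + _ - x]addrAC subrr add0r enormZ ?(ltW t0).
  have CS := cauchy_schwarz (grad f (x + t *: d) - grad f x) d.
  have := ler_wpM2r (enorm_ge0 d) lip_t.
  move: CS; rewrite /dh -enorm_sq !dotE; lra.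
move: ht; rewrite /h scale0r scale1r addr0 /d [x + (y - x)]addrC subrK -/d.
lra.
Qed.

End Descent.

(** * One iteration *)

(** The scalar part of the one-step bound.  Here P is the gap
    <grad f(x), x - y>, G is <grad f(x), xp - x>, D is |xp - x|^2, T and F are
    the decreases of |. - y|^2 and of f, and s is (g1 + g2) |grad f(x)|^2.  The
    first premise is the projection tested at y, the second one the projection
    tested at x, and the third one the descent lemma.  The coefficient
    2 al (1 - 2 g2) of G has to be split: descent takes care of 2 al G, whose
    coefficient no longer depends on g2, and the second premise bounds the
    remainder 4 g2 al G from above whatever the sign of F.  The two error terms
    in s add up to exactly al / (1 - 2 g2) * s, and this is where rho comes
    from. *)
Lemma step_arith {R : realType} (al L g2 g3 gb2 gb a s G D P T F : R) :
  0 < al -> 0 <= g2 -> g2 < gb2 -> gb2 < 1 / 2 -> 0 <= g3 -> g3 < gb ->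
  gb < 1 / 2 -> al * L <= 1 - 2 * gb -> s <= a -> 0 <= a -> 0 <= D ->
  2 * al * P <= T + 2 * al ^+ 2 * s - 2 * al * (1 - 2 * g2) * G
    - (1 - 2 * g2 - 2 * g3) * D ->
  al * (1 - 2 * g2) * G <= al ^+ 2 * s - (1 - g2 - g3) * D ->
  - G <= F + L / 2 * D ->
  P + (1 - 2 * gb - al * L) / (2 * al) * D
    <= T / (2 * al) + F + al / (1 - 2 * gb2) * a.
Proof.
move=> al0 g20 g2b gb2h g30 g3b gbh alL sa a0 D0 H1 H2 H3.
pose rho' := al / (1 - 2 * g2).
have r0 : 0 < 1 - 2 * g2 by lra.
have rho'E : rho' * (1 - 2 * g2) = al by rewrite /rho' divfK// gt_eqF.
have rho'0 : 0 <= rho' by rewrite divr_ge0// ltW.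
have rho'_le : rho' <= al / (1 - 2 * gb2).
  by rewrite ler_pM2l// lef_pV2 ?posrE; lra.
(* 1 - g2 - g3 = (1 - 2 g2) (1 - g3) + g2 (1 - 2 g3), with a nonnegative last
   term. *)
have H2' : al * G <= al * rho' * s - (1 - g3) * D.
  rewrite -(ler_pM2l r0).
  have -> : (1 - 2 * g2) * (al * rho' * s - (1 - g3) * D)
      = al * (rho' * (1 - 2 * g2)) * s - (1 - 2 * g2) * (1 - g3) * D by ring.
  rewrite rho'E; apply: le_trans (_ : al ^+ 2 * s - (1 - g2 - g3) * D <= _).
    by apply: le_trans H2; rewrite le_eqVlt; apply/orP; left; apply/eqP; ring.
  have : 0 <= g2 * (1 - 2 * g3) * D by rewrite !mulr_ge0//; lra.
  lra.
have H2s : 4 * g2 * (al * G) <= 4 * g2 * (al * rho' * s - (1 - g3) * D).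
  by rewrite ler_wpM2l// mulr_ge0.
have H3s : 2 * al * - G <= 2 * al * (F + L / 2 * D).
  by rewrite ler_wpM2l// mulr_ge0// ltW.
have sE : 2 * al ^+ 2 * s + 4 * g2 * (al * rho' * s) = 2 * al * (rho' * s).
  have -> : al ^+ 2 = al * (rho' * (1 - 2 * g2)) by rewrite rho'E expr2.
  ring.
have ss : 2 * al * (rho' * s) <= 2 * al * (al / (1 - 2 * gb2) * a).
  rewrite ler_pM2l; last by lra.
  exact: le_trans (ler_wpM2l rho'0 sa) (ler_wpM2r a0 rho'_le).
(* The coefficient of D that remains to be discarded. *)
have gD : 0 <= (2 * (gb - g3) + 2 * g2 * (1 - 2 * g3)) * D.
  by rewrite mulr_ge0// addr_ge0 ?mulr_ge0//; lra.
have al2 : 0 < 2 * al by lra.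
rewrite -(ler_pM2l al2).
have -> : 2 * al * (P + (1 - 2 * gb - al * L) / (2 * al) * D)
   = 2 * al * P + (1 - 2 * gb - al * L) * D by field; rewrite gt_eqF.
have -> : 2 * al * (T / (2 * al) + F + al / (1 - 2 * gb2) * a)
   = T + 2 * al * F + 2 * al * (al / (1 - 2 * gb2) * a).
  by field; rewrite !gt_eqF//; lra.
lra.
Qed.

Section Method.
Context {R : realType} {n : nat}.
Implicit Types (C : set 'rV[R]_n) (f : 'rV[R]_n -> R).

(** The inexact projection inequality tested at y, with the tolerance replaced
    by its upper bound and everything expanded in terms of the step xp - x and
    of y - x. *)
Lemma inexact_proj_gradient_step C
    (phi : R -> R -> R -> 'rV[R]_n -> 'rV[R]_n -> 'rV[R]_n -> R)
    (g1 g2 g3 alpha : R) (x xp g y : 'rV[R]_n) :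
  error_tolerance phi -> 0 <= g1 -> 0 <= g2 -> 0 <= g3 ->
  inexact_proj C (phi g1 g2 g3) x (x - alpha *: g) xp -> C y ->
  dot (xp - x) (xp - x) - dot (xp - x) (y - x)
    + alpha * (dot g (xp - x) - dot g (y - x))
  <= (g1 + g2) * alpha ^+ 2 * dot g g
    + 2 * alpha * g2 * dot g (xp - x) + (g2 + g3) * dot (xp - x) (xp - x).
Proof.
move=> phi_tol g10 g20 g30 [_ proj] Cy.
have := le_trans (proj y Cy)
  (phi_tol g1 g2 g3 g10 g20 g30 x (x - alpha *: g) xp).2.
rewrite !enorm_sq.
have -> : x - alpha *: g - x = - (alpha *: g) by rewrite addrAC subrr add0r.
have -> : xp - (x - alpha *: g) = xp - x + alpha *: g by rewrite opprB addrCA addrC.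
have -> : x - alpha *: g - xp = - (xp - x + alpha *: g).
  by rewrite opprD opprB addrAC.
have -> : y - xp = (y - x) - (xp - x) by rewrite opprB addrA subrK.
move: (xp - x) (y - x) => d e.
rewrite !dotE (dotC d g); lra.
Qed.

Lemma gradient_step_bound f C
    (phi : R -> R -> R -> 'rV[R]_n -> 'rV[R]_n -> 'rV[R]_n -> R)
    (L alpha gbar2 gbar a g1 g2 g3 : R) (x xp y : 'rV[R]_n) :
  convex_set C -> (forall z, differentiable f z) ->
  lipschitz_gradient_on f C L -> error_tolerance phi ->
  0 < alpha -> gbar2 < 1 / 2 -> gbar < 1 / 2 -> alpha * L <= 1 - 2 * gbar ->
  0 <= g1 -> 0 <= g2 -> 0 <= g3 -> g2 < gbar2 -> g3 < gbar -> 0 <= a ->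
  (g1 + g2) * dot (grad f x) (grad f x) <= a ->
  C x -> inexact_proj C (phi g1 g2 g3) x (x - alpha *: grad f x) xp -> C y ->
  dot (grad f x) (x - y)
    + (1 - 2 * gbar - alpha * L) / (2 * alpha) * dot (xp - x) (xp - x)
  <= (dot (x - y) (x - y) - dot (xp - y) (xp - y)) / (2 * alpha)
    + (f x - f xp) + alpha / (1 - 2 * gbar2) * a.
Proof.
move=> Cconv df lip phi_tol al0 gb2 gb alL g10 g20 g30 g2b g3b a0 ga Cx proj Cy.
have Cxp : C xp by case: proj.
have Hy := inexact_proj_gradient_step _ _ _ _ _ _ _ _ _ _ phi_tol g10 g20 g30 proj Cy.
have Hx := inexact_proj_gradient_step _ _ _ _ _ _ _ _ _ _ phi_tol g10 g20 g30 proj Cx.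
have Hf := descent_lemma f C L x xp Cconv df lip Cx Cxp.
move: Hx; rewrite subrr !dot0r => Hx.
have xy : x - y = - (y - x) by rewrite opprB.
have xpy : xp - y = (xp - x) - (y - x) by rewrite opprB addrA subrK.
move: Hx Hy Hf ga; rewrite xy xpy; move: (xp - x) (y - x) => d e Hx Hy Hf ga.
apply: (@step_arith _ alpha L g2 g3 gbar2 gbar a
  ((g1 + g2) * dot (grad f x) (grad f x)) (dot (grad f x) d)) => //.
- exact: dotvv_ge0.
- rewrite !dotE (dotC e d); lra.
- lra.
- lra.
Qed.

(** * The whole run *)

Lemma GInexPM_mem C f phi (a : nat -> R) gbar2 gbar alpha (x : nat -> 'rV[R]_n) :
  GInexPM C f phi a gbar2 gbar alpha x -> forall k, C (x k).
Proof.
move=> [C0 gen]; elim=> // k Ck; have [stop cont] := gen k.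
have [/eqP/stop->//|/eqP/cont] := boolP (grad f (x k) == 0).
by move=> [g1 [g2 [g3 [_ _ _ _ []]]]].
Qed.

(** Telescoping gives the sharper bound bm1 - b_(N-1), from which the
    nonnegative b_(N-1) is dropped (b_(-1) = bm1 when N = 0). *)
Lemma sum_tolerances_le (bm1 : R) (b a : nat -> R) N :
  admissible_parameters bm1 b a -> \sum_(0 <= k < N) a k <= bm1.
Proof.
move=> [_ b_ge0 _ [bm1_gt0 _] ab].
apply: (@le_trans _ _ (bm1 - prev_seq bm1 b N)); last first.
  by rewrite gerBl; case: N => [|N] /=; [exact: ltW | exact: b_ge0].
elim: N => [|N IH]; first by rewrite big_nil /= subrr.
rewrite big_nat_recr//=; have := (ab N).2; lra.
Qed.

(** The one-step bounds summed over k < N.  An iteration with a zero gradient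
    repeats its point, and the one-step bound then reads 0 <= rho a_k.  The
    squared terms are kept for the equality case. *)
Lemma GInexPM_energy f C phi (L bm1 alpha gbar2 gbar : R) (b a : nat -> R)
    (x : nat -> 'rV[R]_n) y N :
  convex_set C -> (forall z, differentiable f z) ->
  lipschitz_gradient_on f C L -> error_tolerance phi ->
  admissible_parameters bm1 b a ->
  0 < alpha -> gbar2 < 1 / 2 -> gbar < 1 / 2 -> alpha * L <= 1 - 2 * gbar ->
  GInexPM C f phi a gbar2 gbar alpha x -> C y ->
  \sum_(0 <= k < N) (dot (grad f (x k)) (x k - y)
    + (1 - 2 * gbar - alpha * L) / (2 * alpha)
      * dot (x k.+1 - x k) (x k.+1 - x k))
  + dot (x N - y) (x N - y) / (2 * alpha)
  <= dot (x 0%N - y) (x 0%N - y) / (2 * alpha) + (f (x 0%N) - f (x N))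
    + alpha / (1 - 2 * gbar2) * bm1.
Proof.
move=> Cconv df lip phi_tol params al0 gb2 gb alL gen Cy.
have rho0 : 0 <= alpha / (1 - 2 * gbar2) by rewrite divr_ge0//; lra.
have Cx := GInexPM_mem _ _ _ _ _ _ _ _ gen.
have a_ge0 k : 0 <= a k by case: params => _ _ _ _ /(_ k)[].
have step k : dot (grad f (x k)) (x k - y)
      + (1 - 2 * gbar - alpha * L) / (2 * alpha)
        * dot (x k.+1 - x k) (x k.+1 - x k)
    <= (dot (x k - y) (x k - y) - dot (x k.+1 - y) (x k.+1 - y)) / (2 * alpha)
      + (f (x k) - f (x k.+1)) + alpha / (1 - 2 * gbar2) * a k.
  have [stop cont] := gen.2 k.
  have [g0|/eqP g0] := eqVneq (grad f (x k)) 0.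
    by rewrite (stop g0) g0 !subrr !dot0l mulr0 mul0r !add0r mulr_ge0.
  have [g1 [g2 [g3 [[g10 g20 g30] ga g2b g3b proj]]]] := cont g0.
  apply: (gradient_step_bound f C phi _ _ _ _ _ g1 g2 g3) => //.
  rewrite -enorm_sq -ler_pdivlMr// exprn_gt0// lt_def enorm_ge0 andbT.
  by apply/eqP => /enorm_eq0.
apply: (@le_trans _ _ (dot (x 0%N - y) (x 0%N - y) / (2 * alpha)
    + (f (x 0%N) - f (x N))
    + alpha / (1 - 2 * gbar2) * \sum_(0 <= k < N) a k)); last first.
  by rewrite lerD2l ler_wpM2l// (sum_tolerances_le _ b).
elim: N => [|N IH]; first by rewrite !big_nil; lra.
rewrite !big_nat_recr//=; have := step N; lra.
Qed.

End Method.

Theorem theorem12 (R : realType) (n : nat) (C : set 'rV[R]_n)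
    (f : 'rV[R]_n -> R) (L : R)
    (phi : R -> R -> R -> 'rV[R]_n -> 'rV[R]_n -> 'rV[R]_n -> R)
    (bm1 : R) (b a : nat -> R) (gbar2 gbar alpha : R) (x : nat -> 'rV[R]_n)
    (C_closed : closed C)
    (C_convex : convex_set C)
    (f_C1 : continuously_differentiable f)
    (L_gt0 : 0 < L)
    (f_lip : lipschitz_gradient_on f C L)
    (phi_tol : error_tolerance phi)
    (params : admissible_parameters bm1 b a)
    (gbar2_lt : gbar2 < 1 / 2)
    (gbar_lt : gbar < 1 / 2)
    (alpha_gt0 : 0 < alpha)
    (alpha_lt : alpha < (1 - 2 * gbar) / L)
    (x_gen : GInexPM C f phi a gbar2 gbar alpha x)
    (Omega_neq0 : minimizers f C !=set0) :
  let rho := alpha / (1 - 2 * gbar2) in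
  let eta := f (x 0%N) - optimal_value f C + rho * bm1 in
  (forall (N : nat) (y : 'rV[R]_n), C y ->
     \big[Num.min/dot (grad f (x 0%N)) (x 0%N - y)]_(0 <= k < N.+1)
        dot (grad f (x k)) (x k - y)
     <= (1 / (2 * alpha) * enorm (x 0%N - y) ^+ 2 + eta) * (1 / N.+1%:R)) /\
  (forall (eps : R), 0 < eps -> forall y : 'rV[R]_n, C y ->
     forall N : nat,
       (1 / (2 * alpha) * enorm (x 0%N - y) ^+ 2 + eta) / eps - 1 <= N%:R ->
       exists2 l : nat, (l <= N)%N & - eps < dot (grad f (x l)) (y - x l)).
Proof.
move=> rho eta.
have alL : alpha * L < 1 - 2 * gbar by rewrite -ltr_pdivlMr.
have f_ge k : optimal_value f C <= f (x k).
  have [z [_ zmin]] := Omega_neq0.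
  apply: ge_inf; first by exists (f z) => _ [w Cw <-]; exact: zmin.
  by exists (x k) => //; exact: (GInexPM_mem _ _ _ _ _ _ _ _ x_gen).
have energy N y : C y ->
    \sum_(0 <= k < N) dot (grad f (x k)) (x k - y)
    + (1 - 2 * gbar - alpha * L) / (2 * alpha)
      * (\sum_(0 <= k < N) dot (x k.+1 - x k) (x k.+1 - x k))
    + dot (x N - y) (x N - y) / (2 * alpha)
    <= 1 / (2 * alpha) * enorm (x 0%N - y) ^+ 2 + eta.
  move=> Cy; rewrite mulr_sumr -big_split /=.
  apply: le_trans (GInexPM_energy f C phi L bm1 alpha gbar2 gbar b a x y N
    C_convex f_C1.1 f_lip phi_tol params alpha_gt0 gbar2_lt gbar_lt (ltW alL)
    x_gen Cy) _.
  rewrite enorm_sq /eta /rho; have := f_ge N; lra.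
have c_gt0 : 0 < (1 - 2 * gbar - alpha * L) / (2 * alpha).
  by rewrite divr_gt0//; lra.
have al2_gt0 : 0 < 2 * alpha by lra.
have sum_sq_ge0 N : 0 <= \sum_(0 <= k < N) dot (x k.+1 - x k) (x k.+1 - x k).
  by apply: sumr_ge0 => k _; exact: dotvv_ge0.
split=> [N y Cy | eps eps_gt0 y Cy N].
  rewrite [1 / N.+1%:R]mul1r ler_pdivlMr ?ltr0n//.
  set m := \big[_/_]_(_ <= k < _) _.
  apply: le_trans (energy N.+1 y Cy).
  apply: (@le_trans _ _ (\sum_(0 <= k < N.+1) dot (grad f (x k)) (x k - y))).
    rewrite mulr_natr -[X in m *+ X]subn0 -sumr_const_nat.
    apply: ler_sum_nat => k kN; apply: ge_bigmin_seq => //.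
    by rewrite mem_index_iota.
  rewrite -addrA lerDl; apply: addr_ge0; apply: mulr_ge0;
    by rewrite ?invr_ge0 ?dotvv_ge0 ?sum_sq_ge0// ltW.
rewrite lerBlDr natr1 ler_pdivrMr// => KN.
apply: contrapT => no_iterate.
have eps_le k : (k <= N)%N -> eps <= dot (grad f (x k)) (x k - y).
  move=> kN; rewrite leNgt; apply/negP => lt_eps; apply: no_iterate.
  by exists k => //; rewrite -(opprB (x k)) dotNr ltrN2.
(* With KN this forces equality in the energy inequality at N.+1. *)
have sum_ge : N.+1%:R * eps <= \sum_(0 <= k < N.+1) dot (grad f (x k)) (x k - y).
  rewrite mulr_natl -[X in eps *+ X]subn0 -sumr_const_nat.
  by apply: ler_sum_nat => k kN; exact: eps_le.
have := energy N.+1 y Cy.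
set S := \sum_(_ <= k < _) dot (x _ - _) _; set Q := dot _ _ => en.
have cS_ge0 : 0 <= (1 - 2 * gbar - alpha * L) / (2 * alpha) * S.
  by apply: mulr_ge0; [exact: ltW | exact: sum_sq_ge0].
have Q_ge0 : 0 <= Q / (2 * alpha) by rewrite divr_ge0 ?dotvv_ge0// ltW.
have S0 : S = 0.
  have : (1 - 2 * gbar - alpha * L) / (2 * alpha) * S = 0 by lra.
  by move/eqP; rewrite mulf_eq0 gt_eqF//= => /eqP.
have Q0 : Q = 0.
  have : Q / (2 * alpha) = 0 by lra.
  by move/eqP; rewrite mulf_eq0 invr_eq0 (gt_eqF al2_gt0) orbF => /eqP.
have xSN : x N.+1 - x N = 0.
  apply: dotvv_eq0; apply: le_anti; rewrite dotvv_ge0 andbT.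
  by move: S0; rewrite /S big_nat_recr//= => <-; rewrite lerDr.
have xNy : x N - y = 0.
  by rewrite -(dotvv_eq0 _ Q0) (subr0_eq xSN).
by have := eps_le N (leqnn N); rewrite xNy dot0r leNgt eps_gt0.
Qed.
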